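(* Let $\{G_n\}$ be a Gibonacci sequence. For all integers $p\geq 2$ and $m\geq p-1$, $$\begin{aligned} &\sum_{\substack{k=p\\ k\equiv p \ (\mathrm{mod}\ 2)}}^{m-1}\left(G_1\binom{(k+p-4)/2}{p-2}+G_0\binom{(k+p-4)/2}{p-1} \right)G_{m-k}\\ &\quad+\left(G_1\binom{(m+p-4)/2}{p-2}+G_0\binom{(m+p-4)/2}{p-1}\right)G_1\\ &\quad+\sum_{\substack{t=0\\ t\equiv m \ (\mathrm{mod}\ 2)}}^{p-1}\left(G_1^2\binom{(m+t-4)/2}{t-2}+2G_0G_1\binom{(m+t-4)/2}{t-1}+G_0^2\binom{(m+t-4)/2}{t} \right)\\ &=G_1G_{m-1}+G_0G_{m-2}. \end{aligned}$$
   Context: A Gibonacci sequence is a sequence satisfying $G_n=G_{n-1}+G_{n-2}$, with initial values $G_0,G_1$ chosen freely (here arbitrary integers), extended to negative indices by the same recurrence, so $G_{-1}=G_1-G_0$. Empty sums are $0$. The binomial coefficient $\binom{n}{r}$ is zero if $n$ is not an integer. For an integer $n$ (possibly negative), $\binom{n}{r}=0$ if $r<0$, and $\binom{n}{r}=\frac{n(n-1)\cdots(n-r+1)}{r!}$ if $r\ge 0$ (so $\binom{n}{0}=1$ for every integer $n$, including $n=-1$). *)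

(* Defs.v *)
From HB Require Import structures.
From mathcomp Require Import all_boot all_order all_algebra.

Set Implicit Arguments.
Unset Strict Implicit.
Unset Printing Implicit Defensive.

Import Order.TTheory GRing.Theory Num.Theory.
Local Open Scope ring_scope.

Definition gibonacci (G : int -> int) : Prop :=
  forall n : int, G n = G (n - 1) + G (n - 2).

(* The upper argument is rational because half-integers occur there; the      *)
(* coefficient then vanishes. Negative integer upper arguments are allowed:   *)
(* binomQ (-1) 0 = 1 and binomQ (-1) 1 = -1.                                  *)
Definition binomQ (x : rat) (r : int) : rat :=
  if x \is a Num.int then
    match r with
    | Posz n => (\prod_(i < n) (x - i%:R)) / n`!%:R
    | Negz _ => 0
    end
  else 0.

(* Main.v *)
Require Import Defs.
From HB Require Import structures.
From mathcomp Require Import all_boot all_order all_algebra.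
From mathcomp Require Import ring zify.

Import Order.TTheory GRing.Theory Num.Theory.
Local Open Scope ring_scope.

(** The left-hand side is a sum of three parts, all built from the numbers
    [edge g0 g1 m t = g1 C((m+t-4)/2, t-2) + g0 C((m+t-4)/2, t-1)] and
    [corner g0 g1 m t = g1^2 C(n,t-2) + 2 g0 g1 C(n,t-1) + g0^2 C(n,t)] with
    [n = (m+t-4)/2].  Half-integral upper arguments give zero, so the parity
    conditions on the summation indices can be dropped.

    Pascal's rule makes both families satisfy
    [f (m+2) t = f m t + f (m+1) (t-1)], and
    [corner m t = g1 edge m t + g0 edge (m-1) (t+1)].  For fixed [p], the
    convolution part (with its boundary term) fails the Fibonacci recurrence in
    [m] by exactly [g0 edge m p + g1 edge (m+1) (p-1) = corner (m+1) (p-1)],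
    while the corner sum, by telescoping in [t], fails it by the opposite
    amount.  Hence the left-hand side is a Gibonacci sequence in [m]
    ([lhs_rec]), as the right-hand side is, and it remains to compare two
    consecutive values, [m = p-1] and [m = p].

    The comparison is an induction on [p]: at [m = p] and [m = p+1] the left-hand
    sides for [p] and [p+1] coincide ([lhs_shift_diag], [lhs_shift_succ]),
    because apart from summands of the wrong parity they differ only by diagonal
    entries [C(n,n) = 1] and entries [C(n,r) = 0] with [r > n].  The case
    [p = 2] is computed directly. *)

(** * Binomial coefficients with rational upper argument *)

Lemma binomQ_neg (x : rat) n : binomQ x (Negz n) = 0.
Proof. by rewrite /binomQ; case: ifP. Qed.

Lemma binomQ_pascal (x : rat) (r : int) :
  binomQ (x + 1) r = binomQ x r + binomQ x (r - 1).
Proof.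
case: r => [[|n]|n].
- rewrite sub0r (_ : - 1 = Negz 0) // binomQ_neg addr0.
  by rewrite /binomQ rpredDr ?rpred1 // !big_ord0.
- have -> : n.+1%:Z - 1 = n%:Z by lia.
  rewrite /binomQ rpredDr ?rpred1 //; case: ifP => // _.
  have -> : \prod_(i < n.+1) (x + 1 - i%:R) = (x + 1) * \prod_(i < n) (x - i%:R).
    rewrite big_ord_recl subr0; congr (_ * _); apply: eq_bigr => i _.
    by rewrite lift0 -natr1; ring.
  rewrite big_ord_recr /= factS natrM.
  have f0 : n`!%:R != 0 :> rat by rewrite pnatr_eq0 -lt0n fact_gt0.
  have n0 : n.+1%:R != 0 :> rat by rewrite pnatr_eq0.
  by move: n0; rewrite -natr1 => n0; field; rewrite f0.
- rewrite (_ : Negz n - 1 = Negz n.+1) ?binomQ_neg ?addr0 //; lia.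
Qed.

Lemma binomQ_nat n r : binomQ n%:R r%:Z = 'C(n, r)%:R.
Proof.
elim: n r => [|n IHn] [|r].
- by rewrite /binomQ rpred0 big_ord0 divr1.
- by rewrite /binomQ rpred0 big_ord_recl subrr mul0r mul0r.
- by rewrite /binomQ rpred_nat big_ord0 bin0 divr1.
- rewrite -natr1 binomQ_pascal IHn (_ : r.+1%:Z - 1 = r%:Z); last lia.
  by rewrite IHn binS natrD.
Qed.

Lemma binomQ_half_odd (k t : nat) r : (k == t %[mod 2])%N = false ->
  binomQ ((k%:R + t%:R - 4) / 2) r = 0.
Proof.
move=> kt; rewrite /binomQ; case: ifP => // /intrP [z zE].
have : (k%:Z + t%:Z - 4)%:~R = (z * 2)%:~R :> rat.
  rewrite intrM -zE -mulrA mulVf ?mulr1 //.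
  by rewrite !rmorphD /= rmorphN.
by move/intr_inj => E; exfalso; lia.
Qed.

(** * The two arrays of summands *)

Definition edge (g0 g1 : rat) (m t : int) : rat :=
  g1 * binomQ ((m%:~R + t%:~R - 4) / 2) (t - 2)
  + g0 * binomQ ((m%:~R + t%:~R - 4) / 2) (t - 1).

Definition corner (g0 g1 : rat) (m t : int) : rat :=
  g1 ^+ 2 * binomQ ((m%:~R + t%:~R - 4) / 2) (t - 2)
  + 2 * g0 * g1 * binomQ ((m%:~R + t%:~R - 4) / 2) (t - 1)
  + g0 ^+ 2 * binomQ ((m%:~R + t%:~R - 4) / 2) t.

(** The two middle products [g0 g1 C(n,t-1)] go one to each edge: shifting
    [(m,t)] to [(m-1,t+1)] keeps [n] and raises the lower arguments. *)
Lemma cornerE g0 g1 m t :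
  corner g0 g1 m t = g1 * edge g0 g1 m t + g0 * edge g0 g1 (m - 1) (t + 1).
Proof.
rewrite /corner /edge.
have -> : ((m - 1)%:~R + (t + 1)%:~R - 4) / 2 = (m%:~R + t%:~R - 4) / 2 :> rat.
  by rewrite !rmorphD rmorphN /=; ring.
rewrite (_ : t + 1 - 2 = t - 1) ?addrK; last lia.
ring.
Qed.

Lemma edge_pascal g0 g1 m t :
  edge g0 g1 (m + 2) t = edge g0 g1 m t + edge g0 g1 (m + 1) (t - 1).
Proof.
rewrite /edge.
have -> : ((m + 2)%:~R + t%:~R - 4) / 2 = (m%:~R + t%:~R - 4) / 2 + 1 :> rat.
  by rewrite !rmorphD /=; field.
have -> : ((m + 1)%:~R + (t - 1)%:~R - 4) / 2 = (m%:~R + t%:~R - 4) / 2 :> rat.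
  by rewrite !rmorphD rmorphN /=; field.
rewrite !binomQ_pascal.
rewrite (_ : t - 1 - 2 = t - 2 - 1); last lia.
ring.
Qed.

Lemma corner_pascal g0 g1 m t :
  corner g0 g1 (m + 2) t = corner g0 g1 m t + corner g0 g1 (m + 1) (t - 1).
Proof.
rewrite !cornerE edge_pascal.
rewrite (_ : m + 2 - 1 = m - 1 + 2) ?edge_pascal; last lia.
rewrite [m + 1 - 1]addrAC [t - 1 + 1]addrAC.
ring.
Qed.

Lemma edge_odd g0 g1 (k t : nat) : (k == t %[mod 2])%N = false ->
  edge g0 g1 k t = 0.
Proof. by move=> kt; rewrite /edge !binomQ_half_odd // !mulr0 addr0. Qed.

Lemma corner_odd g0 g1 (k t : nat) : (t == k %[mod 2])%N = false ->
  corner g0 g1 k t = 0.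
Proof. by move=> kt; rewrite /corner !binomQ_half_odd 1?eq_sym // !mulr0 !addr0. Qed.

Lemma corner_neg g0 g1 m n : corner g0 g1 m (Negz n) = 0.
Proof.
rewrite /corner.
have -> : Negz n - 2 = Negz n.+2 by lia.
have -> : Negz n - 1 = Negz n.+1 by lia.
by rewrite !binomQ_neg !mulr0 !addr0.
Qed.

Lemma diag_upper_arg p : ((p + 2)%:R + (p + 2)%:R - 4) / 2 = p%:R :> rat.
Proof. by rewrite natrD; field. Qed.

Lemma edge_diag g0 g1 (p : nat) : edge g0 g1 (p + 2)%N (p + 2)%N = g1.
Proof.
rewrite /edge diag_upper_arg.
have -> : (p + 2)%:Z - 2 = p%:Z by lia.
have -> : (p + 2)%:Z - 1 = p.+1%:Z by lia.
by rewrite !binomQ_nat binn bin_small // mulr1 mulr0 addr0.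
Qed.

Lemma corner_diag g0 g1 (p : nat) :
  corner g0 g1 (p + 2)%N (p + 2)%N = g1 ^+ 2.
Proof.
rewrite /corner diag_upper_arg.
have -> : (p + 2)%:Z - 2 = p%:Z by lia.
have -> : (p + 2)%:Z - 1 = p.+1%:Z by lia.
rewrite !binomQ_nat binn !bin_small ?mulr1 ?mulr0 ?addr0 //; lia.
Qed.

(** Telescoping in [t] of the Pascal recurrence; the boundary entry at [t = -1]
    has only negative lower indices. *)
Lemma corner_sum_pascal g0 g1 (m : int) (p : nat) :
  \sum_(0 <= t < p) corner g0 g1 (m + 2) t =
  \sum_(0 <= t < p) corner g0 g1 m t
  + \sum_(0 <= t < p) corner g0 g1 (m + 1) t - corner g0 g1 (m + 1) (p%:Z - 1).
Proof.
elim: p => [|p IHp].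
  by rewrite !big_geq // (_ : 0%:Z - 1 = Negz 0) // corner_neg !addr0.
rewrite !big_nat_recr //= IHp corner_pascal (_ : p.+1%:Z - 1 = p%:Z); last lia.
ring.
Qed.

(** * The left-hand side without parity conditions *)

Definition convolution (g : int -> rat) (p m : nat) : rat :=
  \sum_(p <= k < m) edge (g 0) (g 1) k p * g (m%:Z - k%:Z).

Definition lhs (g : int -> rat) (p m : nat) : rat :=
  convolution g p m + edge (g 0) (g 1) m p * g 1
  + \sum_(0 <= t < p) corner (g 0) (g 1) m t.

(** At [m = p-1] the last summand lies below the range of summation, but it
    vanishes for parity reasons, so the sum can be split there as well. *)
Lemma sum_edge_recr g0 g1 (p m : nat) (f : nat -> rat) : (p <= m.+1)%N ->
  \sum_(p <= k < m.+1) edge g0 g1 k p * f k =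
  \sum_(p <= k < m) edge g0 g1 k p * f k + edge g0 g1 m p * f m.
Proof.
rewrite leq_eqVlt => /orP [/eqP -> | pm]; last by rewrite big_nat_recr.
rewrite !big_geq // edge_odd ?mul0r ?addr0 //; lia.
Qed.

(** Applying the recurrence to each factor [g (m+2-k)] gives the two shorter
    convolutions; the edge terms come from the indices [k = m] and [k = m+1],
    which the shorter sums do not reach. *)
Lemma convolution_rec (g : int -> rat) (p m : nat) :
  (forall n, g n = g (n - 1) + g (n - 2)) -> (p <= m.+1)%N ->
  convolution g p m.+2 = convolution g p m.+1 + convolution g p m
    + edge (g 0) (g 1) m p * g 0 + edge (g 0) (g 1) m.+1 p * g 1.
Proof.
move=> gE pm; rewrite /convolution.
rewrite (sum_edge_recr _ _ _ _ (fun k => g (m.+2%:Z - k%:Z))); last exact: leqW.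
rewrite (sum_edge_recr _ _ _ _ (fun k => g (m.+2%:Z - k%:Z))) //.
rewrite (sum_edge_recr _ _ _ _ (fun k => g (m.+1%:Z - k%:Z))) //.
rewrite (_ : \sum_(p <= k < m) _ * g (m.+2%:Z - k%:Z) =
  \sum_(p <= k < m) edge (g 0) (g 1) k p * g (m.+1%:Z - k%:Z)
  + \sum_(p <= k < m) edge (g 0) (g 1) k p * g (m%:Z - k%:Z)); last first.
  rewrite -big_split /=; apply: eq_bigr => k _.
  rewrite -mulrDr (gE (m.+2%:Z - k%:Z)).
  have -> : m.+2%:Z - k%:Z - 1 = m.+1%:Z - k%:Z by lia.
  by have -> : m.+2%:Z - k%:Z - 2 = m%:Z - k%:Z by lia.
have -> : m.+2%:Z - m%:Z = 2 by lia.
have -> : m.+2%:Z - m.+1%:Z = 1 by lia.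
have -> : m.+1%:Z - m%:Z = 1 by lia.
have -> : g 2 = g 1 + g 0 by rewrite gE.
ring.
Qed.

(** The defects of the two parts cancel: [edge_pascal] leaves
    [g0 edge m p + g1 edge (m+1) (p-1)] for the convolution with its boundary
    term, and by [cornerE] this is the corner missing from the telescoped sum. *)
Lemma lhs_rec (g : int -> rat) (p m : nat) :
  (forall n, g n = g (n - 1) + g (n - 2)) -> (p <= m.+1)%N ->
  lhs g p m.+2 = lhs g p m.+1 + lhs g p m.
Proof.
move=> gE pm; rewrite /lhs convolution_rec //.
have -> : m.+2%:Z = m%:Z + 2 by lia.
have -> : m.+1%:Z = m%:Z + 1 by lia.
rewrite corner_sum_pascal edge_pascal cornerE.
by rewrite addrK subrK; ring.
Qed.

(** Here the corner sum gains [corner p p = g1^2] just as the boundary term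
    [edge p p * g1 = g1^2] disappears by parity. *)
Lemma lhs_shift_diag (g : int -> rat) (p : nat) :
  lhs g (p + 2).+1 (p + 2) = lhs g (p + 2) (p + 2).
Proof.
rewrite /lhs /convolution (@big_geq _ _ _ (p + 2).+1) //.
rewrite (@big_geq _ _ _ (p + 2)%N) // big_nat_recr //=.
rewrite edge_odd ?corner_diag ?edge_diag; last lia.
ring.
Qed.

(** Here the new corner vanishes by parity, and the product [g1 * g1] moves: for
    the smaller parameter it is the only summand of the convolution, for the
    larger one it is the boundary term. *)
Lemma lhs_shift_succ (g : int -> rat) (p : nat) :
  lhs g (p + 2).+1 (p + 2).+1 = lhs g (p + 2) (p + 2).+1.
Proof.
rewrite /lhs /convolution big_geq // big_nat1 big_nat_recr //=.
rewrite corner_odd; last lia.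
rewrite (@edge_odd _ _ (p + 2).+1 (p + 2)); last lia.
rewrite -{1 2}addSn !edge_diag (_ : (p + 2).+1%:Z - (p + 2)%:Z = 1); last lia.
ring.
Qed.

Lemma lhs_2 (g : int -> rat) : (forall n, g n = g (n - 1) + g (n - 2)) ->
  lhs g 2 1 = g 1 * g 0 + g 0 * g (- 1) /\ lhs g 2 2 = g 1 * g 1 + g 0 * g 0.
Proof.
move=> gE; have gN1 : g (- 1) = g 1 - g 0 by rewrite (gE 1) addrC addKr.
have b0 : binomQ (-1) 0 = 1 by rewrite /binomQ rpredN1 /= big_ord0.
have b1 : binomQ (-1) 1 = -1 by rewrite /binomQ rpredN1 /= big_ord1.
split; rewrite /lhs /convolution big_geq // big_nat_recr //=;
  rewrite big_nat_recr //= big_geq // !add0r.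
- rewrite edge_odd // (@corner_odd _ _ 1 0) // /corner.
  rewrite (_ : (1%:~R + 1%:~R - 4) / 2 = -1 :> rat) // binomQ_neg b0 b1 gN1.
  ring.
- rewrite (edge_diag _ _ 0) (@corner_odd _ _ 2 1) // /corner.
  rewrite (_ : (2%:~R + 0%:~R - 4) / 2 = -1 :> rat) // !binomQ_neg b0.
  ring.
Qed.

Lemma lhs_closed_form (g : int -> rat) (p m : nat) :
  (forall n, g n = g (n - 1) + g (n - 2)) -> (2 <= p)%N -> (p <= m.+1)%N ->
  lhs g p m = g 1 * g (m%:Z - 1) + g 0 * g (m%:Z - 2).
Proof.
move=> gE; pose rhs (n : int) := g 1 * g (n - 1) + g 0 * g (n - 2).
have rhs_rec_int n : rhs n = rhs (n - 1) + rhs (n - 2).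
  rewrite /rhs [in LHS](gE (n - 1)) [in LHS](gE (n - 2)).
  by rewrite [n - 1 - 2]addrAC; ring.
have rhs_rec (n : nat) : rhs n.+2 = rhs n.+1 + rhs n.
  rewrite rhs_rec_int; congr (rhs _ + rhs _); lia.
have from_base q : lhs g q.+1 q = rhs q -> lhs g q.+1 q.+1 = rhs q.+1 ->
    forall d, lhs g q.+1 (d + q) = rhs (d + q)%N.
  move=> b0 b1 d.
  suff [] : lhs g q.+1 (d + q) = rhs (d + q)%N
         /\ lhs g q.+1 (d + q).+1 = rhs (d + q).+1 by [].
  elim: d => [|d [IH0 IH1]] //; split; first exact: IH1.
  by rewrite addSn lhs_rec ?IH0 ?IH1 ?rhs_rec //; lia.
have base q : lhs g q.+2 q.+1 = rhs q.+1 /\ lhs g q.+2 q.+2 = rhs q.+2.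
  elim: q => [|q [IH0 IH1]]; first by have := lhs_2 g gE.
  rewrite -(addn2 q) lhs_shift_diag lhs_shift_succ !addn2; split => //.
(* m = p + 1 lies one step beyond the two base values known for p. *)
  by have := from_base _ IH0 IH1 2%N; rewrite !add2n.
case: p => [|[|q]] // _ qm.
have [b0 b1] := base q.
have := from_base _ b0 b1 (m - q.+1)%N.
by rewrite subnK.
Qed.

Theorem theorem3p8 (G : int -> int) (hG : gibonacci G)
    (p m : nat) (hp : (2 <= p)%N) (hm : (p - 1 <= m)%N) :
  \sum_(p <= k < m | (k == p %[mod 2])%N)
     ((G 1)%:Q * binomQ ((k%:R + p%:R - 4) / 2) (p%:Z - 2)
      + (G 0)%:Q * binomQ ((k%:R + p%:R - 4) / 2) (p%:Z - 1))
     * (G (m%:Z - k%:Z))%:Q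
  + ((G 1)%:Q * binomQ ((m%:R + p%:R - 4) / 2) (p%:Z - 2)
     + (G 0)%:Q * binomQ ((m%:R + p%:R - 4) / 2) (p%:Z - 1)) * (G 1)%:Q
  + \sum_(0 <= t < p | (t == m %[mod 2])%N)
     ((G 1)%:Q ^+ 2 * binomQ ((m%:R + t%:R - 4) / 2) (t%:Z - 2)
      + 2 * (G 0)%:Q * (G 1)%:Q * binomQ ((m%:R + t%:R - 4) / 2) (t%:Z - 1)
      + (G 0)%:Q ^+ 2 * binomQ ((m%:R + t%:R - 4) / 2) t%:Z)
  = (G 1)%:Q * (G (m%:Z - 1))%:Q + (G 0)%:Q * (G (m%:Z - 2))%:Q.
Proof.
have gE n : (G n)%:Q = (G (n - 1))%:Q + (G (n - 2))%:Q.
  by rewrite [in LHS]hG rmorphD.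
rewrite -(lhs_closed_form (fun n => (G n)%:Q) p m gE hp); last lia.
rewrite /lhs /convolution; congr (_ + _ + _).
- rewrite big_mkcond; apply: eq_bigr => k _ /=; case: ifP => // kp.
  by rewrite edge_odd ?mul0r.
- rewrite big_mkcond; apply: eq_bigr => t _ /=; case: ifP => // tm.
  by rewrite corner_odd.
Qed.
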